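(* Let $p$ be a prime number, let $c \ge p$ be an integer, and let $S$ be a numerical semigroup. Then $S$ is a saturated numerical semigroup with multiplicity $p$ and conductor $c$ if and only if one of the following holds: (i) $c \equiv 0 \pmod p$ and $S = \langle p, c+1, c+2, \dots, c+p-1\rangle$; (ii) $c \equiv i \pmod p$ for some $i \in \{2,3,\dots,p-1\}$ and $S = \langle p, c, c+1, \dots, c+p-i-1, c+p-i+1, \dots, c+p-1\rangle$ (that is, $S$ is generated by $p$ together with all integers in $\{c, c+1, \dots, c+p-1\}$ except $c+p-i$).
   Context: Let $\mathbf{N}$ denote the set of non-negative integers. A numerical semigroup is a subset $S \subseteq \mathbf{N}$ that is closed under addition, contains $0$, and has finite complement in $\mathbf{N}$. For a nonempty $A \subseteq \mathbf{N}$, $\langle A\rangle$ denotes the submonoid of $(\mathbf{N},+)$ generated by $A$. The multiplicity of $S$ is the least positive element of $S$ (equivalently, the smallest minimal generator). The conductor of $S$ is the least integer $s$ such that $s+n \in S$ for all $n \in \mathbf{N}$. For $s \in S\setminus\{0\}$ put $d_S(s) = \gcd\{x \in S : x \le s\}$. $S$ is called saturated if $s + d_S(s) \in S$ for all $s \in S \setminus\{0\}$. *)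

(* Defs.v *)
From mathcomp Require Import all_boot all_order.
From mathcomp Require Import boolp classical_sets cardinality.

Set Implicit Arguments.
Unset Strict Implicit.
Unset Printing Implicit Defensive.

Local Open Scope classical_set_scope.
Local Open Scope nat_scope.

Definition submonoid (M : set nat) : Prop :=
  M 0 /\ (forall x y : nat, M x -> M y -> M (x + y)).

Definition numerical_semigroup (S : set nat) : Prop :=
  submonoid S /\ finite_set (~` S).

Definition generated (A : set nat) : set nat := smallest submonoid A.

Definition is_least (A : set nat) (m : nat) : Prop :=
  A m /\ (forall x : nat, A x -> m <= x).

Definition is_multiplicity (S : set nat) (m : nat) : Prop :=
  is_least [set x | S x /\ 0 < x] m.

Definition is_conductor (S : set nat) (c : nat) : Prop :=
  is_least [set s | forall n : nat, S (s + n)] c.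

(* The initial value 0 and the term x = 0 are harmless, as gcdn 0 n = n. *)
Definition dgcd (S : set nat) (s : nat) : nat :=
  \big[gcdn/0]_(0 <= x < s.+1 | x \in S) x.

Definition saturated (S : set nat) : Prop :=
  forall s : nat, S s -> s <> 0 -> S (s + dgcd S s).

(* Main.v *)
Require Import Defs.
From mathcomp Require Import all_boot all_order.
From mathcomp Require Import boolp classical_sets cardinality.
From mathcomp Require Import zify.

Local Open Scope classical_set_scope.
Local Open Scope nat_scope.

(** Both generating sets generate the same semigroup [T], made of the multiples
    of [p] and of all integers [>= c]; the two cases only record that [c] is not
    congruent to [1] modulo [p], i.e. that [c - 1] is not in [T].  If a saturated
    [S] of multiplicity [p] contains some [x] prime to [p], then
    [d_S (x + n) = 1] for all [n], so [S] contains every integer [>= x] and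
    [c <= x]; hence [S = T]. *)

Definition multiples_or_ge (p c : nat) : set nat := [set x | p %| x \/ c <= x].

Lemma dgcd_dvd (S : set nat) (s x : nat) : S x -> x <= s -> dgcd S s %| x.
Proof.
move=> Sx le_xs; rewrite /dgcd big_mkord.
by apply: (biggcdn_inf (Ordinal (le_xs : x < s.+1))) => //=; apply/mem_set.
Qed.

Lemma dvd_dgcd (S : set nat) (s d : nat) :
  (forall x, S x -> x <= s -> d %| x) -> d %| dgcd S s.
Proof.
move=> dS; rewrite /dgcd big_mkord; apply/dvdn_biggcdP => i /set_mem Si.
by apply: dS => //; rewrite -ltnS.
Qed.

Lemma submonoid_mull (M : set nat) (a k : nat) :
  submonoid M -> M a -> M (k * a).
Proof.
by move=> [M0 MD] Ma; elim: k => // k IH; rewrite mulSn; apply: MD.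
Qed.

Lemma submonoid_multiples_or_ge (p c : nat) : submonoid (multiples_or_ge p c).
Proof.
split=> [|x y]; first by left.
case=> [px|cx] [py|cy]; rewrite /multiples_or_ge /=; last 3 first.
- by right; rewrite (leq_trans cy) // leq_addl.
- by right; rewrite (leq_trans cx) // leq_addr.
- by right; rewrite (leq_trans cx) // leq_addr.
by left; rewrite dvdn_add.
Qed.

(** The window of [p] consecutive integers starting at [c] meets every residue class modulo [p], so
    adding multiples of [p] to its members reaches everything from [c] on. Members divisible by [p]
    come for free from [p] itself, so [A] may omit them. *)
Lemma generated_multiples_or_ge (p c : nat) (A : set nat) :
  0 < p -> A p -> A `<=` multiples_or_ge p c ->
  (forall r, c <= r < c + p -> A r \/ p %| r) ->
  generated A = multiples_or_ge p c.
Proof.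
move=> p_gt0 Ap AT Ar; apply/seteqP; split=> [x gx|x Tx].
  by apply: gx; split=> //; apply: submonoid_multiples_or_ge.
move=> M [Mmon AM].
have Mmul y : p %| y -> M y.
  by move=> /dvdnP[k ->]; apply: submonoid_mull => //; apply: AM.
case: Tx => [/Mmul//|le_cx].
(* Split [x] into the window member of its residue class plus a multiple of [p]. *)
have -> : x = c + (x - c) %% p + (x - c) %/ p * p.
  by rewrite -addnA [_ %% p + _]addnC -divn_eq subnKC.
apply: Mmon.2; last exact/Mmul/dvdn_mull.
case: (Ar (c + (x - c) %% p)) => [|/AM//|/Mmul//].
by rewrite leq_addr ltn_add2l ltn_mod.
Qed.

Lemma generated_case0 (p c : nat) : 0 < p -> p %| c ->
  generated ([set p] `|` [set x | c + 1 <= x <= c + p - 1])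
  = multiples_or_ge p c.
Proof.
move=> p_gt0 pc; apply: generated_multiples_or_ge => //; first by left.
  by move=> x [->|/=]; [left | right; lia].
move=> r; case: (eqVneq r c) => [->|ne_rc] r_bounds; first by right.
by left; right => /=; lia.
Qed.

Lemma generated_casei (p c i : nat) : i <= p - 1 -> 0 < p -> c = i %[mod p] ->
  generated ([set p] `|` [set x | c <= x <= c + p - 1 /\ x <> c + p - i])
  = multiples_or_ge p c.
Proof.
move=> le_ip p_gt0 ci; apply: generated_multiples_or_ge => //; first by left.
  by move=> x [->|/= [x_bounds _]]; [left | right; lia].
(* The omitted value [c + p - i] is divisible by [p], because [c] and [i] agree modulo [p]. *)
move=> r; case: (eqVneq r (c + p - i)) => [->|/eqP ne_r] r_bounds.
  right; rewrite -eqn_mod_dvd; last lia.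
  by rewrite modnDr ci.
by left; right => /=; split=> //; lia.
Qed.

Lemma multiples_or_ge_spec (p c : nat) :
  1 < p -> p <= c -> c <> 1 %[mod p] ->
  [/\ saturated (multiples_or_ge p c),
      is_multiplicity (multiples_or_ge p c) p &
      is_conductor (multiples_or_ge p c) c].
Proof.
move=> p_gt1 le_pc c_neq1; split.
- move=> s Ts s_neq0.
  have [le_cs|lt_sc] := leqP c s; first by right; rewrite (leq_trans le_cs) ?leq_addr.
  (* Below [c] only multiples of [p] occur, so [p] divides both [s] and [dgcd], hence their sum. *)
  have pT x : multiples_or_ge p c x -> x <= s -> p %| x.
    by case=> // le_cx le_xs; move: (leq_trans le_cx le_xs); rewrite leqNgt lt_sc.
  by left; rewrite dvdn_add ?dvd_dgcd ?pT.
- split=> [|x [[px|le_cx] x_gt0]].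
  + by split; [left | apply: ltnW].
  + exact: dvdn_leq.
  + exact: leq_trans le_cx.
- split=> [n|y Ty]; first by right; apply: leq_addr.
  (* A smaller candidate [y] would force [c - 1] into the set; being less than [c], it would be a
     multiple of [p], against [c_neq1]. *)
  rewrite leqNgt; apply/negP => lt_yc; case: (Ty (c - 1 - y)) => [|]; last lia.
  rewrite subnKC; last lia.
  by rewrite -eqn_mod_dvd; [move/eqP | lia].
Qed.

Lemma saturated_coprime_ge (p x n : nat) (S : set nat) :
  prime p -> saturated S -> S p -> S x -> p <= x -> ~~ (p %| x) -> S (x + n).
Proof.
move=> p_prime satS Sp Sx le_px px; elim: n => [|n IH]; first by rewrite addn0.
suff d1 : dgcd S (x + n) = 1.
  by rewrite addnS -addn1 -{1}d1; apply: satS => //; have := prime_gt0 p_prime; lia.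
(* Both [p] and [x] are elements at most [x + n], so [dgcd] divides their gcd, which is 1. *)
apply/eqP; rewrite -dvdn1 -(eqP (_ : coprime p x)) ?prime_coprime //.
by rewrite dvdn_gcd !dgcd_dvd // ?leq_addr // (leq_trans le_px) ?leq_addr.
Qed.

Lemma saturated_eq (p c : nat) (S : set nat) : prime p -> submonoid S ->
  saturated S -> is_multiplicity S p -> is_conductor S c ->
  S = multiples_or_ge p c.
Proof.
move=> p_prime Smon satS [[Sp _] p_min] [Sc c_min].
apply/seteqP; split=> x.
  move=> Sx; case: (boolP (p %| x)) => px; [by left | right].
  have x_gt0 : 0 < x by case: x px {Sx}; rewrite ?dvdn0.
  by apply: c_min => n; apply: (saturated_coprime_ge p) => //; apply: p_min.
case=> [/dvdnP[k ->]|le_cx]; first exact: submonoid_mull.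
by rewrite -(subnKC le_cx); apply: Sc.
Qed.

(** If [c] were 1 modulo [p], then [c - 1] would be a multiple of [p], and every integer from
    [c - 1] on would belong to the set, contradicting minimality of [c]. Positivity of [c] keeps the
    truncated [c - 1] strictly smaller. *)
Lemma conductor_neq1_mod (p c : nat) : 0 < c ->
  is_conductor (multiples_or_ge p c) c -> c <> 1 %[mod p].
Proof.
move=> c_gt0 [_ c_min] c1; suff : c <= c - 1 by lia.
apply: c_min => -[|n]; last by right; lia.
by left; rewrite addn0 -eqn_mod_dvd //; apply/eqP.
Qed.

Theorem theorem1 (p c : nat) (S : set nat)
    (p_prime : prime p) (le_pc : p <= c) (S_ns : numerical_semigroup S) :
  (saturated S /\ is_multiplicity S p /\ is_conductor S c) <->
  ((c = 0 %[mod p] /\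
    S = generated ([set p] `|` [set x | c + 1 <= x <= c + p - 1])) \/
   (exists i : nat,
      2 <= i <= p - 1 /\
      c = i %[mod p] /\
      S = generated ([set p] `|`
            [set x | c <= x <= c + p - 1 /\ x <> c + p - i]))).
Proof.
have p_gt1 := prime_gt1 p_prime; have p_gt0 := prime_gt0 p_prime.
split=> [[satS [mulS condS]]|].
  have ST := saturated_eq _ c _ p_prime S_ns.1 satS mulS condS.
  have c_neq1 : c <> 1 %[mod p].
    by apply: conductor_neq1_mod; [lia | rewrite -ST].
  have lt_cp : c %% p < p by rewrite ltn_mod.
  have [c0|c_neq0] := eqVneq (c %% p) 0.
    by left; rewrite mod0n generated_case0 // /dvdn c0.
  (* The residue of [c] is neither 0 nor 1, so it lies between 2 and [p - 1]. *)
  right; exists (c %% p); rewrite modn_mod; split.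
    by move: c_neq1; rewrite (modn_small p_gt1); lia.
  by split=> //; rewrite generated_casei ?modn_mod //; lia.
case=> [[c0 ->]|[i [i_bounds [ci ->]]]].
  rewrite generated_case0 //; last by rewrite /dvdn c0 mod0n.
  have [|] := @multiples_or_ge_spec p c p_gt1 le_pc; last by [].
  by rewrite c0 mod0n modn_small.
rewrite generated_casei //; last lia.
have [|] := @multiples_or_ge_spec p c p_gt1 le_pc; last by [].
by rewrite ci !modn_small //; lia.
Qed.
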